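(* For any programs $S$ and $S'$, the following are equivalent: (i) $S\sqsubseteq S'$; (ii) for every projector $Q$, $wlp.S.Q\sqsubseteq wlp.S'.Q$; (iii) for every projector $P$, $sp.S.P\sqsupseteq sp.S'.P$.
   Context: Let $V$ be a finite set of qubit variables, $\mathcal{H}_W=\bigotimes_{q\in W}\mathcal{H}_q$ with $\mathcal{H}_q\cong\mathbb{C}^2$; operators on subsystems are identified with their extension by identity to $\mathcal{H}_V$. Projectors are identified with subspaces, $\sqsubseteq$ is inclusion (Löwner order), $P^\perp$ orthocomplement. $\mathcal{D}(\mathcal{H})$: partial density operators; $\mathcal{SO}(\mathcal{H})$: completely positive trace-nonincreasing super-operators; $\rho\models P$ iff the support of $\rho$ is contained in $P$. Programs: $S::=\mathbf{skip}\mid\mathbf{abort}\mid \bar q:=0\mid \bar q \mathrel{*}= U\mid \mathbf{assert}\ P[\bar q]\mid [P,Q]_{\bar q}\mid S_0\oplus_p S_1\mid S_0;S_1\mid \mathbf{if}\ P[\bar q]\ \mathbf{then}\ S_1\ \mathbf{else}\ S_0\ \mathbf{end}\mid \mathbf{while}\ P[\bar q]\ \mathbf{do}\ S\ \mathbf{end}$, with denotations (sets of super-operators): $\llbracket\mathbf{skip}\rrbracket=\{\mathrm{id}\}$; $\llbracket\mathbf{abort}\rrbracket=\{0\}$; $\llbracket \bar q:=0\rrbracket=\{\rho\mapsto\sum_i|0\rangle_{\bar q}\langle i|\rho|i\rangle_{\bar q}\langle 0|\}$; $\llbracket\bar q\mathrel{*}=U\rrbracket=\{\rho\mapsto U\rho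 U^\dagger\}$; $\llbracket\mathbf{assert}\ P[\bar q]\rrbracket=\{\rho\mapsto P\rho P\}$; $\llbracket[P,Q]_{\bar q}\rrbracket=\{\mathcal{E}\in\mathcal{SO}(\mathcal{H}_{\bar q}):\forall\rho\models P,\ \mathcal{E}(\rho)\models Q\}$; $\llbracket S_0\oplus_pS_1\rrbracket=\{p\mathcal{E}_0+(1-p)\mathcal{E}_1\}$; $\llbracket S_0;S_1\rrbracket=\{\mathcal{E}_1\circ\mathcal{E}_0\}$; $\llbracket\mathbf{if}\ P[\bar q]\ldots\rrbracket=\{\mathcal{E}_1\circ\mathcal{P}+\mathcal{E}_0\circ\mathcal{P}^\perp\}$ ($\mathcal{P}(\rho)=P\rho P$, $\mathcal{P}^\perp(\rho)=P^\perp\rho P^\perp$); $\llbracket\mathbf{while}\ P[\bar q]\ \mathbf{do}\ S\ \mathbf{end}\rrbracket=\{\sum_{k\ge0}\mathcal{P}^\perp\circ\mathcal{E}_k\circ\mathcal{P}\circ\cdots\circ\mathcal{E}_1\circ\mathcal{P}:\mathcal{E}_i\in\llbracket S\rrbracket\}$, with $\mathcal{E}_i\in\llbracket S_i\rrbracket$ chosen independently. $\models\{P\}S\{Q\}$ iff for all $\rho\in\mathcal{D}(\mathcal{H}_V)$, $\mathcal{E}\in\llbracket S\rrbracket$: $\rho\models P\Rightarrow\mathcal{E}(\rho)\models Q$. $wlp.S.Q$ is the (existing) $\sqsubseteq$-greatest $P$ with $\models\{P\}S\{Q\}$; $sp.S.P$ is the (existing) $\sqsubseteq$-least $Q$ with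 $\models\{P\}S\{Q\}$. Refinement: $S\sqsubseteq S'$ iff for all projectors $P,Q$ on $\mathcal{H}_V$, $\models\{P\}S\{Q\}$ implies $\models\{P\}S'\{Q\}$. *)

(* Defs.v *)
From HB Require Import structures.
From mathcomp Require Import all_boot all_order all_algebra.
From mathcomp Require Import all_classical all_reals all_analysis.
From mathcomp.real_closed Require Import complex.
From Stdlib Require Import ClassicalEpsilon.
Import numFieldNormedType.Exports.
Set Implicit Arguments. Unset Strict Implicit. Unset Printing Implicit Defensive.
Import Order.TTheory GRing.Theory Num.Theory.
Local Open Scope classical_set_scope.
Local Open Scope ring_scope.

(*  V : finType = the finite set of qubit variables.                         *)
(*  Computational basis of H_V : {ffun V -> bool}; H_V = C^(#|{ffun V->bool}|)*)
(*  A (sub)register \bar q is a sequence q : seq V (distinct variables);     *)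
(*  H_q has basis {ffun 'I_(size q) -> bool} (k-th bit = value of q_k).      *)

Notation qdim k := #|{ffun 'I_k -> bool}|.
Notation vdim V := #|{ffun V -> bool}|.

Section Defs.
Variable R : realType.
Local Notation C := R[i].

Definition adjmx m n (A : 'M[C]_(m, n)) : 'M[C]_(n, m) := (map_mx Num.conj A)^T.

Definition psd d (A : 'M[C]_d) : Prop :=
  forall v : 'cV[C]_d, 0 <= (adjmx v *m A *m v) 0 0.

Definition loewner d (A B : 'M[C]_d) : Prop := psd (B - A).

Definition projector d (P : 'M[C]_d) : Prop := P *m P = P /\ adjmx P = P.

Definition unitary d (U : 'M[C]_d) : Prop := adjmx U *m U = 1%:M.

Definition pdo d (rho : 'M[C]_d) : Prop := psd rho /\ \tr rho <= 1.

(* rho |= P : the support (range) of rho is contained in (the range of) P *)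
Definition sat d (rho P : 'M[C]_d) : Prop := forall v : 'cV[C]_d, P *m (rho *m v) = rho *m v.

Definition superop d := 'M[C]_d -> 'M[C]_d.

Definition is_linear d (E : superop d) : Prop :=
  forall (a : C) (X Y : 'M[C]_d), E (a *: X + Y) = a *: E X + E Y.

(* block decomposition of an index of C^m (x) C^d *)
Definition blk m d (k : 'I_(m * d)) : 'I_m * 'I_d := enum_val (cast_ord (esym (mxvec_cast m d)) k).

(* ampliation id_m (x) E *)
Definition ampl m d (E : superop d) (X : 'M[C]_(m * d)) : 'M[C]_(m * d) :=
  \matrix_(k, l)
    E (\matrix_(i, j) X (mxvec_index (blk k).1 i) (mxvec_index (blk l).1 j))
      (blk k).2 (blk l).2.

Definition completely_positive d (E : superop d) : Prop :=
  forall m (X : 'M[C]_(m * d)), psd X -> psd (ampl E X).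

Definition SO d (E : superop d) : Prop :=
  [/\ is_linear E, completely_positive E &
      forall rho : 'M[C]_d, psd rho -> \tr (E rho) <= \tr rho].

Variable V : finType.
Local Notation HV := 'M[C]_(vdim V).

Definition getq (q : seq V) (x : {ffun V -> bool}) : {ffun 'I_(size q) -> bool} :=
  [ffun j => x (tnth (in_tuple q) j)].

Definition setq (q : seq V) (x : {ffun V -> bool}) (i : {ffun 'I_(size q) -> bool})
  : {ffun V -> bool} :=
  [ffun v => match [pick j | tnth (in_tuple q) j == v] with
             | Some j => i j | None => x v end].

Arguments getq : clear implicits.
Arguments setq : clear implicits.

(* A on H_q  |->  A (x) I on H_V *)
Definition ext (q : seq V) (A : 'M[C]_(qdim (size q))) : HV :=
  \matrix_(x, y)
    (A (enum_rank (getq q (enum_val x))) (enum_rank (getq q (enum_val y))) *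
     [forall v, (v \notin q) ==> (enum_val x v == enum_val y v)]%:R).

(* E on H_q  |->  E (x) id on H_V *)
Definition ext_so (q : seq V) (E : superop (qdim (size q))) : superop (vdim V) :=
  fun rho => \matrix_(x, y)
    E (\matrix_(i, j) rho (enum_rank (setq q (enum_val x) (enum_val i)))
                          (enum_rank (setq q (enum_val y) (enum_val j))))
      (enum_rank (getq q (enum_val x))) (enum_rank (getq q (enum_val y))).

Definition zero_state k : {ffun 'I_k -> bool} := [ffun => false].

Inductive prog : Type :=
| Skip
| Abort
| Init of seq V
| Apply (q : seq V) of 'M[C]_(qdim (size q))
| Assert (q : seq V) of 'M[C]_(qdim (size q))
| Spec (q : seq V) of 'M[C]_(qdim (size q)) & 'M[C]_(qdim (size q))
| Choice of R & prog & prog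
| Seq of prog & prog
| If (q : seq V) of 'M[C]_(qdim (size q)) & prog & prog
| While (q : seq V) of 'M[C]_(qdim (size q)) & prog.

Fixpoint wf (Sx : prog) : Prop :=
  match Sx with
  | Skip | Abort => True
  | Init q => uniq q
  | Apply q U => uniq q /\ unitary U
  | Assert q P => uniq q /\ projector P
  | Spec q P Q => [/\ uniq q, projector P & projector Q]
  | Choice p S0 S1 => [/\ 0 <= p <= 1, wf S0 & wf S1]
  | Seq S0 S1 => wf S0 /\ wf S1
  | If q P S1 S0 => [/\ uniq q, projector P, wf S1 & wf S0]
  | While q P Sx => [/\ uniq q, projector P & wf Sx]
  end.

Definition series_to d (u : nat -> 'M[C]_d) (l : 'M[C]_d) : Prop :=
  forall i j,
    (fun N => complex.Re ((\sum_(k < N) u k) i j)) @ \oo --> complex.Re (l i j) /\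
    (fun N => complex.Im ((\sum_(k < N) u k) i j)) @ \oo --> complex.Im (l i j).

(* T_0 = id, T_(k+1) = E_(k+1) o P o T_k  (Es 0 plays the role of E_1) *)
Fixpoint while_iter (Pm : HV) (Es : nat -> superop (vdim V)) (k : nat) (rho : HV) : HV :=
  match k with
  | 0 => rho
  | k'.+1 => Es k' (Pm *m while_iter Pm Es k' rho *m Pm)
  end.

Fixpoint den (Sx : prog) : superop (vdim V) -> Prop :=
  match Sx with
  | Skip => fun E => forall rho, E rho = rho
  | Abort => fun E => forall rho, E rho = 0
  | Init q => fun E => forall rho,
      E rho = \sum_(i : 'I_(qdim (size q)))
                let K := ext (delta_mx (enum_rank (zero_state (size q))) i) in
                K *m rho *m adjmx K
  | Apply q U => fun E => forall rho, E rho = ext U *m rho *m adjmx (ext U)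
  | Assert q P => fun E => forall rho, E rho = ext P *m rho *m ext P
  | Spec q P Q => fun E => exists F : superop (qdim (size q)),
      [/\ SO F,
          (forall rho, pdo rho -> sat rho P -> sat (F rho) Q) &
          forall rho, E rho = ext_so F rho]
  | Choice p S0 S1 => fun E => exists E0 E1, [/\ den S0 E0, den S1 E1 &
      forall rho, E rho = (p%:C)%C *: E0 rho + ((1 - p)%:C)%C *: E1 rho]
  | Seq S0 S1 => fun E => exists E0 E1, [/\ den S0 E0, den S1 E1 &
      forall rho, E rho = E1 (E0 rho)]
  | If q P S1 S0 => fun E => exists E1 E0, [/\ den S1 E1, den S0 E0 &
      forall rho, E rho = E1 (ext P *m rho *m ext P)
                          + E0 (ext (1%:M - P) *m rho *m ext (1%:M - P))]
  | While q P S0 => fun E => exists Es : nat -> superop (vdim V),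
      (forall k, den S0 (Es k)) /\
      forall rho, series_to
        (fun k => ext (1%:M - P) *m while_iter (ext P) Es k rho *m ext (1%:M - P))
        (E rho)
  end.

Definition hoare (P : HV) (Sx : prog) (Q : HV) : Prop :=
  forall rho E, pdo rho -> den Sx E -> sat rho P -> sat (E rho) Q.

Definition is_wlp (Sx : prog) (Q W : HV) : Prop :=
  [/\ projector W, hoare W Sx Q &
      forall P, projector P -> hoare P Sx Q -> loewner P W].

Definition is_sp (Sx : prog) (P T : HV) : Prop :=
  [/\ projector T, hoare P Sx T &
      forall Q, projector Q -> hoare P Sx Q -> loewner T Q].

Definition wlp (Sx : prog) (Q : HV) : HV := epsilon (inhabits 0) (is_wlp Sx Q).
Definition sp (Sx : prog) (P : HV) : HV := epsilon (inhabits 0) (is_sp Sx P).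

Definition refines (Sx Sx' : prog) : Prop :=
  forall P Q : HV, projector P -> projector Q -> hoare P Sx Q -> hoare P Sx' Q.

End Defs.

(* Main.v *)
Require Import Defs.
From HB Require Import structures.
From mathcomp Require Import all_boot all_order all_algebra.
From mathcomp Require Import all_classical all_reals all_analysis.
From mathcomp.real_closed Require Import complex.
From mathcomp Require Import ring.
From Stdlib Require Import ClassicalEpsilon.
Import numFieldNormedType.Exports.
(** The theorem is formal once the weakest liberal precondition and the strongest
    postcondition exist, since then [{P} S {Q}] holds iff [P <= wlp S Q] iff
    [sp S P <= Q].  In finite dimension both exist because the admissible
    projectors contain one of maximal (resp. minimal) rank and are closed under
    joins (resp. meets).  Closure under meets is immediate.  Closure under joins
    uses that every map denoted by a well-formed program is linear and positive:
    a state supported in the join of P1 and P2 is dominated by a sum of a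
    positive operator supported in P1 and one supported in P2, and domination
    of positive operators is inherited by their images and by supports. *)

Set Implicit Arguments. Unset Strict Implicit. Unset Printing Implicit Defensive.
Import Order.TTheory GRing.Theory Num.Theory.
Local Open Scope classical_set_scope.
Local Open Scope ring_scope.

Section Matrices.
Variable R : realType.
Local Notation C := R[i].

(** * Adjoints, quadratic forms and positive semidefinite matrices *)

Lemma adjmxE m n (A : 'M[C]_(m, n)) i j : adjmx A i j = (A j i)^*.
Proof. by rewrite !mxE. Qed.

Lemma adjmxK m n (A : 'M[C]_(m, n)) : adjmx (adjmx A) = A.
Proof. by apply/matrixP => i j; rewrite !mxE conjCK. Qed.

Lemma adjmxM m n p (A : 'M[C]_(m, n)) (B : 'M[C]_(n, p)) :
  adjmx (A *m B) = adjmx B *m adjmx A.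
Proof. by rewrite /adjmx map_mxM trmx_mul. Qed.

Lemma adjmxD m n (A B : 'M[C]_(m, n)) : adjmx (A + B) = adjmx A + adjmx B.
Proof. by rewrite /adjmx map_mxD linearD. Qed.

Lemma adjmxB m n (A B : 'M[C]_(m, n)) : adjmx (A - B) = adjmx A - adjmx B.
Proof. by rewrite /adjmx map_mxB linearB. Qed.

Lemma adjmxZ m n a (A : 'M[C]_(m, n)) : adjmx (a *: A) = a^* *: adjmx A.
Proof. by rewrite /adjmx map_mxZ linearZ. Qed.

Lemma adjmx0 m n : adjmx (0 : 'M[C]_(m, n)) = 0.
Proof. by rewrite /adjmx map_mx0 trmx0. Qed.

Lemma adjmx1 n : adjmx (1%:M : 'M[C]_n) = 1%:M.
Proof. by rewrite /adjmx map_mx1 trmx1. Qed.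

Lemma gram_ge0 m n (A : 'M[C]_(m, n)) j : 0 <= (adjmx A *m A) j j.
Proof.
by rewrite mxE sumr_ge0 // => i _; rewrite adjmxE mulrC mul_conjC_ge0.
Qed.

Lemma gram_eq0 m n (A : 'M[C]_(m, n)) : adjmx A *m A = 0 -> A = 0.
Proof.
move=> A0; apply/matrixP => i j; rewrite mxE.
have /eqP : (adjmx A *m A) j j = 0 by rewrite A0 mxE.
rewrite mxE psumr_eq0; last by move=> k _; rewrite adjmxE mulrC mul_conjC_ge0.
by move=> /allP/(_ i); rewrite mem_index_enum adjmxE mulrC mul_conjC_eq0 => /(_ isT)/eqP.
Qed.

Lemma colv_eq m n (A B : 'M[C]_(m, n)) :
  (forall v : 'cV_n, A *m v = B *m v) -> A = B.
Proof.
move=> AB; apply/matrixP => i j.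
by have /matrixP/(_ i 0) := AB (delta_mx j 0); rewrite -!colE !mxE.
Qed.

Lemma satE d (rho P : 'M[C]_d) : sat rho P <-> P *m rho = rho.
Proof.
split=> [H|H v]; last by rewrite mulmxA H.
by apply: colv_eq => v; rewrite -mulmxA.
Qed.

(** Expanding the vanishing form at [u + v] makes the sesquilinear form [f] antisymmetric; conjugate
    linearity on the left then forces it to vanish. *)
Lemma polarization d (B : 'M[C]_d) :
  (forall v : 'cV[C]_d, (adjmx v *m B *m v) 0 0 = 0) -> B = 0.
Proof.
move=> B0.
pose f (u v : 'cV_d) := (adjmx u *m B *m v) 0 0.
have fDl u v w : f (u + v) w = f u w + f v w by rewrite /f adjmxD !mulmxDl mxE.
have fDr u v w : f u (v + w) = f u v + f u w by rewrite /f mulmxDr mxE.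
have fZl a u v : f (a *: u) v = a^* * f u v.
  by rewrite /f adjmxZ -!scalemxAl mxE.
have fZr a u v : f u (a *: v) = a * f u v by rewrite /f -scalemxAr mxE.
have q u v : f v u = - f u v.
  have := B0 (u + v); rewrite -/(f _ _) fDl !fDr.
  have -> : f u u = 0 by exact: B0.
  have -> : f v v = 0 by exact: B0.
  by rewrite add0r addr0 => /eqP; rewrite addrC addr_eq0 => /eqP.
have z u v : f u v = 0.
  (* The scalar leaves the left slot conjugated and the right slot unchanged, so antisymmetry at
     ['i *: v] reads ['i * f u v = - ('i * f u v)]. *)
  have := q u ('i *: v); rewrite fZl fZr conjCi q mulrNN => /eqP.
  rewrite -addr_eq0 -mulr2n mulrn_eq0 mulf_eq0 (negPf (neq0Ci _)) /=.
  by move/eqP.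
apply/matrixP => i j; rewrite mxE -(z (delta_mx i 0) (delta_mx j 0)) /f.
rewrite -mulmxA -colE mxE (bigD1 i) //= big1 => [|k ki].
  by rewrite adjmxE !mxE !eqxx conjC1 mul1r addr0.
by rewrite adjmxE !mxE (negPf ki) conjC0 mul0r.
Qed.

(** [psd] constrains only the quadratic form, but [0 <= z] in [R[i]] forces [z] to be real, so the
    form of [A - adjmx A] vanishes. *)
Lemma psd_adj d (A : 'M[C]_d) : psd A -> adjmx A = A.
Proof.
move=> psdA; apply/esym/eqP; rewrite -subr_eq0; apply/eqP/polarization => v.
rewrite mulmxBr mulmxBl mxE [X in _ + X]mxE.
have -> : adjmx v *m adjmx A *m v = adjmx (adjmx v *m A *m v).
  by rewrite !adjmxM adjmxK mulmxA.
by rewrite adjmxE geC0_conj ?subrr.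
Qed.

Lemma psd0 d : psd (0 : 'M[C]_d).
Proof. by move=> v; rewrite mulmx0 mul0mx mxE. Qed.

Lemma psdD d (A B : 'M[C]_d) : psd A -> psd B -> psd (A + B).
Proof. by move=> pA pB v; rewrite mulmxDr mulmxDl mxE addr_ge0. Qed.

Lemma psdZ d a (A : 'M[C]_d) : 0 <= a -> psd A -> psd (a *: A).
Proof. by move=> a0 pA v; rewrite -scalemxAr -scalemxAl mxE mulr_ge0. Qed.

Lemma psd_sum d (I : finType) (A : I -> 'M[C]_d) :
  (forall i, psd (A i)) -> psd (\sum_i A i).
Proof.
by move=> pA; apply: (big_ind (@psd R d)); [exact: psd0|exact: psdD|].
Qed.

Lemma psd_congr m d (B : 'M[C]_(m, d)) (A : 'M[C]_d) :
  psd A -> psd (B *m A *m adjmx B).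
Proof.
move=> pA v; have := pA (adjmx B *m v).
by rewrite adjmxM adjmxK !mulmxA.
Qed.

(** Selecting rows and columns along [f], injective or not, is a congruence by a 0/1 matrix. *)
Lemma psd_mxsub m d (f : 'I_m -> 'I_d) (A : 'M[C]_d) : psd A -> psd (mxsub f f A).
Proof.
move=> pA; suff -> : mxsub f f A = rowsub f 1%:M *m A *m adjmx (rowsub f 1%:M).
  exact: psd_congr.
have -> : adjmx (rowsub f (1%:M : 'M[C]_d)) = colsub f 1%:M.
  by apply/matrixP => i j; rewrite !mxE conjC_nat eq_sym.
by rewrite mul_rowsub_mx mul1mx mulmx_colsub mulmx1; apply/matrixP => i j; rewrite !mxE.
Qed.

Lemma psd_tr d (A : 'M[C]_d) : psd A -> 0 <= \tr A.
Proof.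
move=> pA; apply: sumr_ge0 => i _; have := pA (delta_mx i 0).
rewrite -mulmxA -colE mxE (bigD1 i) //= big1 => [|k ki].
  by rewrite adjmxE !mxE !eqxx conjC1 mul1r addr0.
by rewrite adjmxE !mxE (negPf ki) conjC0 mul0r.
Qed.

(** Dividing by [1 + \tr A] rather than by the trace also covers [A = 0]. *)
Lemma pdo_scale d (A : 'M[C]_d) : psd A -> pdo ((1 + \tr A)^-1 *: A).
Proof.
move=> pA; have t0 := psd_tr pA.
have t1 : 0 < 1 + \tr A by rewrite ltr_pwDl.
split; first by apply: psdZ => //; rewrite invr_ge0 ltW.
by rewrite mxtraceZ ler_pdivrMl // mulr1 lerDr.
Qed.

(** With [w = W v] and [u = X w], the form at [w - t u] equals [t (t k - 2 n0)], since [w] is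
    isotropic. A small [t > 0] makes this negative unless [n0], the squared norm of [u], is zero. *)
Lemma psd_isotropic d n (X : 'M[C]_d) (W : 'M[C]_(d, n)) :
  psd X -> adjmx W *m X *m W = 0 -> X *m W = 0.
Proof.
move=> pX WXW; apply: colv_eq => v; rewrite mul0mx -mulmxA.
set w := W *m v; set u := X *m w.
have wXw : adjmx w *m X *m w = 0.
  by rewrite /w adjmxM -!mulmxA (mulmxA X) (mulmxA (adjmx W)) (mulmxA (adjmx W)) WXW mul0mx mulmx0.
have wX : adjmx w *m X = adjmx u by rewrite /u adjmxM (psd_adj pX).
set n0 : C := (adjmx u *m u) 0 0; set k : C := (adjmx u *m X *m u) 0 0.
have n_ge0 : 0 <= n0 by exact: gram_ge0.
have k_ge0 : 0 <= k by exact: pX.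
have quad (t : C) : 0 <= t -> 0 <= t * (t * k - 2 * n0).
  move=> t0; have := pX (w - t *: u).
  have tc : t^* = t by rewrite geC0_conj.
  rewrite adjmxB adjmxZ tc mulmxBl wX !(mulmxBl, mulmxBr) -!scalemxAl -!scalemxAr.
  rewrite -wX wXw wX.
  have -> : adjmx u *m X *m w = adjmx u *m u by rewrite -mulmxA.
  rewrite sub0r; congr (_ <= _).
  have sB (A B : 'M[C]_1) : (A - B) 0 0 = A 0 0 - B 0 0 by rewrite !mxE.
  have sZ a (A : 'M[C]_1) : (a *: A) 0 0 = a * A 0 0 by rewrite mxE.
  have sN (A : 'M[C]_1) : (- A) 0 0 = - A 0 0 by rewrite mxE.
  rewrite !(sN, sB, sZ) -/n0 -/k; ring.
apply: gram_eq0; apply/matrixP => i j; rewrite !ord1 [RHS]mxE -/n0.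
apply/eqP; case: (eqVneq n0 0) => // nn0.
have n_gt0 : 0 < n0 by rewrite lt_def nn0.
have k1 : 0 < k + 1 by rewrite ltr_wpDl.
(* For this [t], [t k < 2 n0]; the 1 added to [k] keeps the denominator positive when [k = 0]. *)
have t_gt0 : 0 < n0 / (k + 1) by rewrite divr_gt0.
have := quad _ (ltW t_gt0).
rewrite pmulr_rge0 // subr_ge0 mulrAC ler_pdivlMr // [2 * n0]mulrC -mulrA ler_pM2l //.
rewrite mulr2n mulrDl mul1r => H.
have : k + 1 <= k by apply: le_trans H; rewrite lerDl ltW.
by rewrite gerDl ler10.
Qed.

(** With [N = 1 - Q], the positive operators [N X N] and [N Z N] sum to zero, so [N X N = 0], and
    [psd_isotropic] upgrades this to [X N = 0]. *)
Lemma psd_sat_addl d (X Z Q : 'M[C]_d) :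
  projector Q -> psd X -> psd Z -> sat (X + Z) Q -> sat X Q.
Proof.
move=> [QQ Qa] pX pZ /satE XZ; apply/satE.
set N := 1%:M - Q; have Na : adjmx N = N by rewrite adjmxB adjmx1 Qa.
have NXZ : N *m X + N *m Z = 0 by rewrite -mulmxDr mulmxBl mul1mx XZ subrr.
suff NX : adjmx N *m X *m N = 0.
  have /(congr1 (@adjmx R _ _)) := psd_isotropic pX NX.
  rewrite adjmxM Na psd_adj // adjmx0 mulmxBl mul1mx => /eqP.
  by rewrite subr_eq0 eq_sym => /eqP.
apply: polarization => v; apply/le_anti/andP; split; last first.
  by have := psd_congr (adjmx N) pX v; rewrite adjmxK.
have /eqP := NXZ; rewrite addr_eq0 Na => /eqP ->.
rewrite !(mulNmx, mulmxN) mxE oppr_le0.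
by have := psd_congr N pZ v; rewrite Na.
Qed.

(** * Projectors, their order, joins and maximal elements *)

Lemma projector_psd d (P : 'M[C]_d) : projector P -> psd P.
Proof.
move=> [PP Pa] v; rewrite -PP -{1}Pa !mulmxA -adjmxM -mulmxA; exact: gram_ge0.
Qed.

Lemma projectorC d (P : 'M[C]_d) : projector P -> projector (1%:M - P).
Proof.
move=> [PP Pa]; split; last by rewrite adjmxB adjmx1 Pa.
by rewrite mulmxBl mul1mx mulmxBr mulmx1 PP subrr subr0.
Qed.

(** If [Q - P] is positive, [P (1 - Q) P = - P (Q - P) P] is both nonnegative and nonpositive, hence
    zero; it is the Gram matrix of [(1 - Q) P]. *)
Lemma loewner_projector d (P Q : 'M[C]_d) :
  projector P -> projector Q -> loewner P Q <-> Q *m P = P.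
Proof.
move=> [PP Pa] [QQ Qa]; split=> [PQ|QP].
  have [NN Na] := projectorC (conj QQ Qa).
  suff : (1%:M - Q) *m P = 0.
    by rewrite mulmxBl mul1mx => /eqP; rewrite subr_eq0 eq_sym => /eqP.
  apply: gram_eq0; rewrite adjmxM Na Pa !mulmxA -(mulmxA P) NN.
  have pPQP := psd_congr P (projector_psd (conj NN Na)).
  rewrite Pa in pPQP.
  apply: polarization => v; apply/le_anti/andP; split; last exact: pPQP.
  have := psd_congr P PQ v; rewrite Pa => PQP.
  have -> : P *m (1%:M - Q) *m P = - (P *m (Q - P) *m P).
    by rewrite !(mulmxBr, mulmxBl) mulmx1 !PP opprB.
  by rewrite mulmxN mulNmx mxE oppr_le0.
rewrite /loewner; apply: projector_psd; split; last by rewrite adjmxB Pa Qa.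
have PQ : P *m Q = P by rewrite -{1}Pa -{1}Qa -adjmxM QP.
by rewrite mulmxBl !mulmxBr QQ PP QP PQ subrr subr0.
Qed.

Lemma sat_loewner d (rho P Q : 'M[C]_d) :
  projector P -> projector Q -> loewner P Q -> sat rho P -> sat rho Q.
Proof.
move=> pP pQ /(loewner_projector pP pQ) QP /satE <-; apply/satE.
by rewrite mulmxA QP.
Qed.

(* J = A G A^* with G a generalized inverse of A^* A. *)
Lemma range_projector d m (A : 'M[C]_(d, m)) :
  exists2 X : 'M[C]_(m, d), projector (A *m X) & A *m X *m A = A.
Proof.
have [H AA] : exists H, adjmx A *m A = H by exists (adjmx A *m A).
have [G HGH] : exists G, H *m G *m H = H by exists (pinvmx H); rewrite mulmxKpV.
(* The defect [D] satisfies [A^* D = 0], and [D^*] ends in the factor [A^*], so [D^* D = 0]. *)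
have AGH : A *m G *m H = A.
  apply/eqP; rewrite -subr_eq0; apply/eqP/gram_eq0.
  set D := _ - A.
  have AD : adjmx A *m D = 0 by rewrite mulmxBr !mulmxA AA HGH subrr.
  by rewrite {1}/D adjmxB !adjmxM mulmxBl -!mulmxA AD !mulmx0 subrr.
exists (G *m adjmx A); last by rewrite -!mulmxA AA mulmxA.
set J := A *m _.
have JA : J *m A = A by rewrite /J -!mulmxA AA mulmxA.
(* [G] may fail to be Hermitian; [J J^* = J] still shows that [J] is. *)
have JJ : J *m adjmx J = J.
  have := congr1 (@adjmx R _ _) JA; rewrite adjmxM => AJ.
  by rewrite {1}/J -!mulmxA AJ.
have Ja : adjmx J = J by rewrite -JJ adjmxM adjmxK.
by split => //; rewrite -{2}Ja.
Qed.

(** The range projector of [row_mx P1 P2] projects onto the sum of the two ranges; the blocks of [X]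
    give the explicit splitting of [J] used to split states. *)
Lemma projector_join d (P1 P2 : 'M[C]_d) :
  projector P1 -> projector P2 ->
  exists J X1 X2, [/\ projector J, J = P1 *m X1 + P2 *m X2, J *m P1 = P1 & J *m P2 = P2].
Proof.
move=> pP1 pP2; have [X pJ JP] := range_projector (row_mx P1 P2).
exists (row_mx P1 P2 *m X), (usubmx X), (dsubmx X).
move: JP; rewrite mul_mx_row => /eq_row_mx[JP1 JP2]; split => //.
by rewrite -mul_row_col vsubmxK.
Qed.

(** For [W] admissible of maximal rank, the join of [W] with an admissible [P] contains [W] and has
    no larger rank, so it equals [W] and [P] lies below [W]. *)
Lemma projector_max d (H : 'M[C]_d -> Prop) (P0 : 'M[C]_d) :
  projector P0 -> H P0 ->
  (forall P1 P2 J X1 X2, projector P1 -> projector P2 -> projector J ->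
     J = P1 *m X1 + P2 *m X2 -> H P1 -> H P2 -> H J) ->
  exists W, [/\ projector W, H W & forall P, projector P -> H P -> loewner P W].
Proof.
move=> pP0 HP0 Hjoin.
pose good r := `[< exists P, [/\ projector P, H P & \rank P = r] >].
have ex_good : exists r, good r by exists (\rank P0); apply/asboolP; exists P0.
have bnd r : good r -> (r <= d)%N by move=> /asboolP[P [_ _ <-]]; exact: rank_leq_row.
case: (ex_maxnP ex_good bnd) => r /asboolP[W [pW HW rW]] rmax.
exists W; split => // P pP HP; apply/(loewner_projector pP pW).
have [J [X1 [X2 [pJ JE JW JP]]]] := projector_join pW pP.
have HJ : H J by exact: Hjoin JE HW HP.
(* [%MS] compares row spaces, so the adjoint of [J W = W] is the form required. *)
have WJ : W *m J = W by case: pW pJ => _ Wa [_ Ja]; rewrite -{1}Wa -{1}Ja -adjmxM JW.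
have sWJ : (W <= J)%MS by rewrite -WJ submxMl.
have rJ : (\rank J <= \rank W)%N by rewrite rW rmax //; apply/asboolP; exists J.
have sJW : (J <= W)%MS by rewrite -(mxrank_leqif_sup sWJ) eqn_leq (mxrankS sWJ).
have JW' : J *m W = J.
  by case/submxP: sJW => D ->; case: pW => WW _; rewrite -mulmxA WW.
by rewrite -{1}JW JW'.
Qed.

(** For positive [X] the second term on the left is positive, so the cross terms of
    [(a + b) X (a + b)^*] are dominated by the right-hand side. *)
Lemma parallelogram d (X a b : 'M[C]_d) :
  (a + b) *m X *m adjmx (a + b) + (a - b) *m X *m adjmx (a - b) =
  2 *: (a *m X *m adjmx a) + 2 *: (b *m X *m adjmx b).
Proof.
rewrite adjmxD adjmxB !(mulmxDl, mulmxDr) !(mulNmx, mulmxN) opprK.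
set p := a *m X *m adjmx a; set s := b *m X *m adjmx b.
set q := a *m X *m adjmx b; set r := b *m X *m adjmx a.
have cancel (M : zmodType) (x y z t : M) :
    x + y + (z + t) + (x - y + (- z + t)) = x *+ 2 + t *+ 2.
  by rewrite addrACA (addrACA x) subrr addr0 (addrACA z) subrr add0r -!mulr2n.
by rewrite !scaler_nat; exact: cancel.
Qed.

(** * Linear positive maps and their closure properties *)

Definition positive_map d (E : superop R d) : Prop :=
  is_linear E /\ forall rho, psd rho -> psd (E rho).

Lemma linear_add d (E : superop R d) X Y : is_linear E -> E (X + Y) = E X + E Y.
Proof. by move=> lE; rewrite -[X]scale1r lE !scale1r. Qed.

Lemma linear_0 d (E : superop R d) : is_linear E -> E 0 = 0.
Proof.
move=> /(linear_add 0 0)/eqP.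
by rewrite addr0 -subr_eq0 opprD addNKr oppr_eq0 => /eqP.
Qed.

Lemma linear_scale d (E : superop R d) a X : is_linear E -> E (a *: X) = a *: E X.
Proof. by move=> lE; rewrite -[a *: X]addr0 lE linear_0 // addr0. Qed.

Lemma positive_map_id d (E : superop R d) : (forall rho, E rho = rho) -> positive_map E.
Proof. by move=> EE; split=> [a X Y|rho]; rewrite !EE. Qed.

Lemma positive_map_zero d (E : superop R d) : (forall rho, E rho = 0) -> positive_map E.
Proof.
move=> EE; split=> [a X Y|rho _]; rewrite !EE; last exact: psd0.
by rewrite scaler0 addr0.
Qed.

Lemma positive_map_kraus d (I : finType) (K : I -> 'M[C]_d) (E : superop R d) :
  (forall rho, E rho = \sum_i K i *m rho *m adjmx (K i)) -> positive_map E.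
Proof.
move=> EE; split=> [a X Y|rho prho]; rewrite !EE; last first.
  by apply: psd_sum => i; exact: psd_congr.
rewrite scaler_sumr -big_split; apply: eq_bigr => i _.
by rewrite /= mulmxDr mulmxDl -scalemxAr -scalemxAl.
Qed.

Lemma positive_map_congr d (K K' : 'M[C]_d) (E : superop R d) :
  K' = adjmx K -> (forall rho, E rho = K *m rho *m K') -> positive_map E.
Proof.
move=> -> EE; apply: (@positive_map_kraus d unit (fun=> K)) => rho.
by rewrite EE (big_pred1 tt) // => -[].
Qed.

Lemma positive_map_comp d (E0 E1 E : superop R d) :
  (forall rho, E rho = E1 (E0 rho)) -> positive_map E0 -> positive_map E1 -> positive_map E.
Proof.
move=> EE [l0 p0] [l1 p1]; split=> [a X Y|rho prho]; rewrite !EE ?l0 ?l1 //.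
by apply: p1; exact: p0.
Qed.

Lemma positive_map_add d (E0 E1 E : superop R d) :
  (forall rho, E rho = E0 rho + E1 rho) -> positive_map E0 -> positive_map E1 -> positive_map E.
Proof.
move=> EE [l0 p0] [l1 p1]; split=> [a X Y|rho prho]; rewrite !EE.
  by rewrite l0 l1 scalerDr addrACA.
by apply: psdD; [exact: p0|exact: p1].
Qed.

Lemma positive_map_scale d (c : C) (E0 E : superop R d) :
  0 <= c -> (forall rho, E rho = c *: E0 rho) -> positive_map E0 -> positive_map E.
Proof.
move=> c0 EE [l0 p0]; split=> [a X Y|rho prho]; rewrite !EE.
  by rewrite l0 scalerDr !scalerA mulrC.
by apply: psdZ => //; exact: p0.
Qed.

(** * Componentwise complex limits and matrix series *)

Definition cvgC (z : nat -> C) (l : C) : Prop :=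
  (fun n => complex.Re (z n)) @ \oo --> complex.Re l /\
  (fun n => complex.Im (z n)) @ \oo --> complex.Im l.

Lemma ReD (x y : C) : complex.Re (x + y) = complex.Re x + complex.Re y.
Proof. by case: x y => [a b] [c d]. Qed.

Lemma ImD (x y : C) : complex.Im (x + y) = complex.Im x + complex.Im y.
Proof. by case: x y => [a b] [c d]. Qed.

Lemma ReM (x y : C) :
  complex.Re (x * y) = complex.Re x * complex.Re y - complex.Im x * complex.Im y.
Proof. by case: x y => [a b] [c d]. Qed.

Lemma ImM (x y : C) :
  complex.Im (x * y) = complex.Re x * complex.Im y + complex.Im x * complex.Re y.
Proof. by case: x y => [a b] [c d]. Qed.

Lemma cvgC_cst (a : C) : cvgC (fun=> a) a.
Proof. by split; exact: cvg_cst. Qed.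

Lemma cvgCD (z w : nat -> C) (a b : C) :
  cvgC z a -> cvgC w b -> cvgC (fun n => z n + w n) (a + b).
Proof.
move=> [za1 za2] [wb1 wb2]; split.
  by under eq_fun do rewrite ReD; rewrite ReD; exact: cvgD.
by under eq_fun do rewrite ImD; rewrite ImD; exact: cvgD.
Qed.

Lemma cvgCM (z w : nat -> C) (a b : C) :
  cvgC z a -> cvgC w b -> cvgC (fun n => z n * w n) (a * b).
Proof.
move=> [za1 za2] [wb1 wb2]; split.
  by under eq_fun do rewrite ReM; rewrite ReM; apply: cvgB; exact: cvgM.
by under eq_fun do rewrite ImM; rewrite ImM; apply: cvgD; exact: cvgM.
Qed.

Lemma cvgC_sum (I : finType) (z : I -> nat -> C) (a : I -> C) :
  (forall i, cvgC (z i) (a i)) -> cvgC (fun n => \sum_i z i n) (\sum_i a i).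
Proof.
move=> za; elim: (index_enum I) => [|i s IH].
  by under eq_fun do rewrite big_nil; rewrite big_nil; exact: cvgC_cst.
by under eq_fun do rewrite big_cons; rewrite big_cons; exact: cvgCD.
Qed.

Lemma cvgC_unique (z : nat -> C) (a b : C) : cvgC z a -> cvgC z b -> a = b.
Proof.
move=> [za1 za2] [zb1 zb2]; apply/eqP; rewrite eq_complex.
by rewrite (cvg_unique _ za1 zb1) // (cvg_unique _ za2 zb2) // !eqxx.
Qed.

Lemma cvgC_ge0 (z : nat -> C) (a : C) : (forall n, 0 <= z n) -> cvgC z a -> 0 <= a.
Proof.
move=> z0 [za1 za2]; rewrite lecE; apply/andP; split.
  have zi n : complex.Im (z n) = 0 by have := z0 n; rewrite lecE => /andP[/eqP].
  rewrite (_ : (fun n => _) = fun=> 0) in za2; last exact/funext.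
  by rewrite (cvg_unique _ za2 (cvg_cst _)).
rewrite -(cvg_lim (@Rhausdorff R) za1); apply: limr_ge; first exact: cvgP za1.
by apply: nearW => n; have := z0 n; rewrite lecE => /andP[].
Qed.

Lemma series_toE d (u : nat -> 'M[C]_d) l :
  series_to u l <-> forall i j, cvgC (fun N => (\sum_(k < N) u k) i j) (l i j).
Proof. by []. Qed.

Lemma series_to_unique d (u : nat -> 'M[C]_d) l l' :
  series_to u l -> series_to u l' -> l = l'.
Proof.
move=> ul ul'; apply/matrixP => i j.
exact: cvgC_unique (ul i j) (ul' i j).
Qed.

Lemma series_to_lin d a (u w : nat -> 'M[C]_d) l m :
  series_to u l -> series_to w m -> series_to (fun k => a *: u k + w k) (a *: l + m).
Proof.
move=> /series_toE ul /series_toE wm; apply/series_toE => i j.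
under eq_fun do rewrite big_split -scaler_sumr mxE [X in X + _]mxE.
rewrite mxE [X in X + _]mxE; apply: cvgCD => //.
by apply: cvgCM => //; exact: cvgC_cst.
Qed.

(** The quadratic form at a fixed [v] is a finite sum of products of entries, so it commutes with
    entrywise limits. *)
Lemma series_to_psd d (u : nat -> 'M[C]_d) l :
  (forall k, psd (u k)) -> series_to u l -> psd l.
Proof.
move=> pu /series_toE ul v.
apply: (@cvgC_ge0 (fun N => (adjmx v *m (\sum_(k < N) u k) *m v) 0 0)) => [N|].
  exact: psd_sum.
under eq_fun do rewrite mxE.
rewrite mxE; apply: cvgC_sum => i; apply: cvgCM; last exact: cvgC_cst.
under eq_fun do rewrite mxE.
rewrite mxE; apply: cvgC_sum => j; apply: cvgCM; last exact: ul.
exact: cvgC_cst.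
Qed.

End Matrices.

Section Programs.
Variables (R : realType) (V : finType).
Local Notation C := R[i].
Local Notation HV := 'M[C]_(vdim V).

(** * Positivity of the maps denoted by programs *)

Lemma ext_adj (q : seq V) (P : 'M[C]_(qdim (size q))) :
  adjmx P = P -> adjmx (ext P) = ext P.
Proof.
move=> Pa; apply/matrixP => x y; rewrite adjmxE !mxE rmorphM /= conjC_nat -adjmxE Pa.
by congr (_ * _%:R); congr nat_of_bool; apply: eq_forallb => v; rewrite eq_sym.
Qed.

Lemma blkK m d i (j : 'I_d) : blk (mxvec_index i j : 'I_(m * d)) = (i, j).
Proof. by rewrite /blk /mxvec_index cast_ordK enum_rankK. Qed.

(* [ext_so F rho] is a compression of the ampliation of F at a pullback of rho
   to the doubled space H_V (x) H_q. *)
Lemma ext_so_psd (q : seq V) (F : superop R (qdim (size q))) (rho : HV) :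
  completely_positive F -> psd rho -> psd (ext_so F rho).
Proof.
move=> cpF prho.
(* [f] overwrites register [q] of a basis state with given bits; [g] pairs a basis state with its
   own content of [q]. *)
pose f (k : 'I_(vdim V * qdim (size q))) : 'I_(vdim V) :=
  enum_rank (setq (enum_val (blk k).1) (enum_val (blk k).2)).
pose g (x : 'I_(vdim V)) := mxvec_index x (enum_rank (getq q (enum_val x))).
suff -> : ext_so F rho = mxsub g g (ampl F (mxsub f f rho)).
  by apply/psd_mxsub/cpF/psd_mxsub.
apply/matrixP => x y; rewrite !mxE !blkK /=; congr (F _ _ _).
by apply/matrixP => i j; rewrite !mxE /f !blkK.
Qed.

Lemma ext_so_linear (q : seq V) (F : superop R (qdim (size q))) :
  is_linear F -> is_linear (@ext_so R V q F).
Proof.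
move=> lF a X Y; apply/matrixP => x y; rewrite !mxE.
set A := (X in F X); set A1 := (X in a * F X _ _); set A2 := (X in _ + F X _ _).
have -> : A = a *: A1 + A2 by apply/matrixP => i j; rewrite !mxE.
by rewrite lF !mxE.
Qed.

Lemma while_iter_positive (P : HV) (Es : nat -> superop R (vdim V)) k :
  adjmx P = P -> (forall k, positive_map (Es k)) ->
  positive_map (while_iter P Es k).
Proof.
move=> Pa pE; elim: k => [|k IH]; first exact: positive_map_id.
apply: (positive_map_comp (E0 := fun rho => P *m while_iter P Es k rho *m P)
  (E1 := Es k)) (pE k) => [//|].
apply: (positive_map_comp (E0 := while_iter P Es k)
  (E1 := fun rho => P *m rho *m P)) IH _ => [//|].
exact: positive_map_congr (fun=> erefl).
Qed.

Lemma positive_map_series (T : nat -> superop R (vdim V)) (E : superop R (vdim V)) :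
  (forall k, positive_map (T k)) -> (forall rho, series_to (fun k => T k rho) (E rho)) ->
  positive_map E.
Proof.
move=> pT TE; split=> [a X Y|rho prho].
  (* Linearity passes to the sum because both sides are limits of the same series. *)
  apply: series_to_unique (TE _) _.
  have -> : (fun k => T k (a *: X + Y)) = (fun k => a *: T k X + T k Y).
    by apply/funext => k; case: (pT k) => lT _; exact: lT.
  exact: series_to_lin.
by apply: series_to_psd (TE rho) => k; case: (pT k) => _; exact.
Qed.

Lemma den_positive (S : prog R V) E : wf S -> den S E -> positive_map E.
Proof.
elim: S E => [|||q U|q P|q P Q|p S0 IH0 S1 IH1|S0 IH0 S1 IH1|q P S1 IH1 S0 IH0|q P S IH] E /=.
- by move=> _; exact: positive_map_id.
- by move=> _; exact: positive_map_zero.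
- by move=> q _; exact: positive_map_kraus.
- by move=> _; exact: positive_map_congr.
- by move=> [_ [_ Pa]]; apply: positive_map_congr; rewrite ext_adj.
(* Positivity of [F] on the register would not suffice here; complete positivity makes its extension
   to the whole space positive. *)
- move=> _ [F [[lF cpF _] _ EE]]; split=> [a X Y|rho prho]; rewrite !EE.
    exact: ext_so_linear.
  exact: ext_so_psd.
- move=> [/andP[p0 p1] w0 w1] [E0 [E1 [d0 d1 EE]]].
  apply: positive_map_add EE _ _.
    by apply: positive_map_scale (fun=> erefl) (IH0 _ w0 d0); rewrite lecR.
  by apply: positive_map_scale (fun=> erefl) (IH1 _ w1 d1); rewrite lecR subr_ge0.
- move=> [w0 w1] [E0 [E1 [d0 d1 EE]]].
  exact: positive_map_comp EE (IH0 _ w0 d0) (IH1 _ w1 d1).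
- move=> [_ pP w1 w0] [E1 [E0 [d1 d0 EE]]].
  have [_ Pa] := pP; have [_ Na] := projectorC pP.
  have compress (A : 'M[C]_(qdim (size q))) (F : superop R (vdim V)) :
      adjmx A = A -> positive_map F ->
      positive_map (fun rho => F (ext A *m rho *m ext A)).
    move=> Aa pF; apply: (positive_map_comp
      (E0 := fun rho => ext A *m rho *m ext A) (E1 := F)) pF => [//|].
    by apply: positive_map_congr (fun=> erefl); rewrite ext_adj.
  apply: positive_map_add EE _ _; apply: compress => //.
    exact: IH1 w1 d1.
  exact: IH0 w0 d0.
move=> [_ pP w] [Es [dEs EE]].
have [_ Pa] := pP; have [_ Na] := projectorC pP.
apply: positive_map_series EE => k.
apply: (positive_map_comp (E0 := while_iter (ext P) Es k)
  (E1 := fun rho => ext (1%:M - P) *m rho *m ext (1%:M - P))) => [//||].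
  by apply: while_iter_positive => [|j]; [exact: ext_adj|exact: IH].
by apply: positive_map_congr (fun=> erefl); rewrite ext_adj.
Qed.

(** * Hoare triples under joins; existence of [wlp] and [sp] *)

Lemma hoare_psd (S : prog R V) (P Q rho : HV) E :
  wf S -> hoare P S Q -> den S E -> psd rho -> sat rho P -> sat (E rho) Q.
Proof.
move=> w H dE prho /satE sP; have [lE pE] := den_positive w dE.
(* Triples concern traces at most 1; rescaling carries them to operators such as [a rho a^*], whose
   trace may be larger. *)
set c := (1 + \tr rho)^-1.
have c0 : c != 0 by rewrite invr_eq0 gt_eqF // ltr_pwDl // psd_tr.
have /satE : sat (E (c *: rho)) Q.
  by apply: H (pdo_scale prho) dE _; apply/satE; rewrite -scalemxAr sP.
rewrite linear_scale // -scalemxAr => /(scalerI c0) ?; exact/satE.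
Qed.

Lemma hoare_join (S : prog R V) (P1 P2 J X1 X2 Q : HV) :
  wf S -> projector P1 -> projector P2 -> projector J -> projector Q ->
  J = P1 *m X1 + P2 *m X2 -> hoare P1 S Q -> hoare P2 S Q -> hoare J S Q.
Proof.
move=> w pP1 pP2 pJ pQ JE H1 H2 rho E [prho _] dE /satE Jrho.
have [lE pE] := den_positive w dE.
set a := P1 *m X1; set b := P2 *m X2; rewrite -/a -/b in JE.
(* [J rho = rho] and its adjoint [rho J = rho] give [rho = J rho J^*]. *)
have rhoE : rho = (a + b) *m rho *m adjmx (a + b).
  by rewrite -JE Jrho -{2}(psd_adj prho) -adjmxM Jrho psd_adj.
(* rho <= 2 a rho a^* + 2 b rho b^*, with terms supported in P1 and P2 *)
have par := parallelogram rho a b; rewrite -rhoE in par.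
have sP (P X : HV) : projector P -> hoare P S Q ->
    Q *m E (P *m X *m rho *m adjmx (P *m X)) = E (P *m X *m rho *m adjmx (P *m X)).
  move=> [PP _] H; apply/satE; apply: hoare_psd H dE _ _ => //; first exact: psd_congr.
  by apply/satE; rewrite !mulmxA PP.
(* The image of [(a - b) rho (a - b)^*] is the positive remainder; added to [E rho] it gives an
   operator supported in [Q]. *)
apply: (psd_sat_addl pQ (pE _ prho) (pE _ (psd_congr (a - b) prho))).
rewrite -(linear_add _ _ lE) par; apply/satE.
by rewrite (linear_add _ _ lE) !(linear_scale _ _ lE) mulmxDr -!scalemxAr !sP.
Qed.

Lemma is_wlp_wlp (S : prog R V) (Q : HV) : wf S -> projector Q -> is_wlp S Q (wlp S Q).
Proof.
move=> w pQ; apply: epsilon_spec.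
apply: (@projector_max R (vdim V) (fun P => hoare P S Q) 0).
- by split; rewrite ?mul0mx ?adjmx0.
(* The zero projector is admissible: it supports only [rho = 0], and [E 0 = 0] by linearity. *)
- move=> rho E _ dE /satE; rewrite mul0mx => <-.
  by have [lE _] := den_positive w dE; apply/satE; rewrite linear_0 // mulmx0.
by move=> P1 P2 J X1 X2 pP1 pP2 pJ; exact: hoare_join.
Qed.

Lemma is_sp_sp (S : prog R V) (P : HV) : is_sp S P (sp S P).
Proof.
apply: epsilon_spec.
(* The least postcondition is the complement of the greatest projector [N] that annihilates every
   output. *)
have [|||N [pN HN Nmax]] := @projector_max R (vdim V) (fun N => hoare P S (1%:M - N)) 0.
- by split; rewrite ?mul0mx ?adjmx0.
- by move=> rho E _ _ _; apply/satE; rewrite subr0 mul1mx.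
- move=> N1 N2 J X1 X2 [_ N1a] [_ N2a] [_ Ja] JE H1 H2 rho E prho dE sP.
  have ker (N : HV) : hoare P S (1%:M - N) -> N *m E rho = 0.
    move=> /(_ rho E prho dE sP)/satE; rewrite mulmxBl mul1mx.
    by rewrite -[RHS]subr0 => /addrI/oppr_inj.
  (* Taking the adjoint of [J = N1 X1 + N2 X2] puts [N1] and [N2] directly against [E rho]. *)
  apply/satE; rewrite mulmxBl mul1mx -Ja JE adjmxD !adjmxM N1a N2a mulmxDl.
  by rewrite -!mulmxA !ker // !mulmx0 addr0 subr0.
exists (1%:M - N); split => //; first exact: projectorC.
move=> Q pQ HQ; rewrite /loewner opprB addrCA -opprB.
by apply: Nmax; [exact: projectorC|rewrite subKr].
Qed.

End Programs.

Theorem theorem4p1 (R : realType) (V : finType) (S S' : prog R V) :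
  wf S -> wf S' ->
  (refines S S' <->
   (forall Q : 'M[R[i]]_(vdim V), projector Q -> loewner (wlp S Q) (wlp S' Q))) /\
  (refines S S' <->
   (forall P : 'M[R[i]]_(vdim V), projector P -> loewner (sp S' P) (sp S P))).
Proof.
move=> w w'; split; split=> [H|H P Q pP pQ HPQ].
- move=> Q pQ; have [pW HW _] := is_wlp_wlp w pQ; have [_ _] := is_wlp_wlp w' pQ.
  by apply => //; exact: H.
(* The state lies in [P], hence in [wlp S Q], hence in [wlp S' Q]. *)
- move=> rho E prho dE sP.
  have [pW _ Wmax] := is_wlp_wlp w pQ; have [pW' HW' _] := is_wlp_wlp w' pQ.
  apply: HW' dE _ => //; apply: sat_loewner (H Q pQ) _ => //.
  by apply: sat_loewner (Wmax P pP HPQ) sP.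
- move=> P pP; have [pT HT _] := is_sp_sp S P; have [_ _] := is_sp_sp S' P.
  by apply => //; exact: H.
(* The output lies in [sp S' P], hence in [sp S P], hence in [Q]. *)
move=> rho E prho dE sP.
have [pT _ Tmin] := is_sp_sp S P; have [pT' HT' _] := is_sp_sp S' P.
apply: sat_loewner (Tmin Q pQ HPQ) _ => //.
by apply: sat_loewner (H P pP) _ => //; exact: HT' sP.
Qed.
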